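(* Let $n,b,a,k$ be positive integers with $b\le\frac n2$, $a\ge1$, $k\ge2$ and $b-k\ge a$. Then the graph $G_{b,a}$ contains a cycle of length $2k$.
   Context: For positive integers $n$, $b$, $a$, the graph $G_{b,a}=(V_b,E_a)$ has vertex set $V_b=\{x=(x_1,\dots,x_n): x_i\in\{0,1\},\ x_1+\dots+x_n=b\}$ and edge set $E_a=\{\{x,y\}: x,y\in V_b,\ (x,y)=a\}$, where $(x,y)$ is the standard inner product. *)

(* Defs.v *)
From mathcomp Require Import all_boot.

Set Implicit Arguments.
Unset Strict Implicit.
Unset Printing Implicit Defensive.

(* 0/1-vectors have boolean entries, read as 0 and 1 through the coercion
   from bool to nat. *)
Definition dotp (n : nat) (x y : {ffun 'I_n -> bool}) : nat :=
  \sum_(i < n) x i * y i.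

Definition vertex (n b : nat) : finType :=
  {x : {ffun 'I_n -> bool} | \sum_(i < n) (x i : nat) == b}.

(* The adjacency relation of G_{b,a}: {x, y} \in E_a.  It is symmetric, and it
   is irreflexive exactly when a <> b or there is no vertex, since
   (x, x) = b. *)
Definition adj (n b a : nat) : rel (vertex n b) :=
  fun x y => dotp (val x) (val y) == a.

(* The bound 2 < m excludes the degenerate closed walks [:: x] (at a loop) and
   [:: x; y] (along a single edge), which satisfy ucycle. *)
Definition has_cycle_of_length (T : finType) (e : rel T) (m : nat) : Prop :=
  2 < m /\ exists c : seq T, size c = m /\ ucycle e c.

(* Main.v *)
Require Import Defs.
From mathcomp Require Import all_boot zify.

(** Put [d = b - a].  For [k >= 3] take disjoint sets [P], [C], [D], [E] of
    sizes [k], [a], [d - 1], [d - k + 2], and write [P = {p_i : i in Z/k}].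
    With [A_i = C + D + {p_i}] and [B_i = C + E + (P - {p_i, p_(i+1)})], both
    [A_i] and [A_(i+1)] meet [B_i] exactly in [C], so [A_0 B_0 A_1 B_1 ...] is a
    cycle; it uses [a + 2 * d + 1 <= 2 * b] points.  For [k = 2] the sets
    [B_0], [B_1] coincide; instead take [A_i = {q_0, q_1, p_i} + C + D] and
    [B_i = {q_i} + C + E] with [C], [D], [E] of sizes [a - 1], [d - 2], [d],
    which again uses [a + 2 * d + 1] points. *)

Lemma sum_ord_count (n : nat) (f : pred nat) :
  \sum_(i < n) (f i : nat) = count f (iota 0 n).
Proof.
rewrite -(big_mkord xpredT (fun i => f i : nat)) /index_iota subn0.
by rewrite -sumn_count sumnE big_map.
Qed.

Lemma count_iota_const (f : pred nat) (u : bool) (p l : nat) :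
  (forall x, p <= x < p + l -> f x = u) -> count f (iota p l) = u * l.
Proof.
move=> fE; rewrite (eq_in_count (a2 := fun=> u)) => [|x].
  by case: u {fE}; rewrite ?count_predT ?count_pred0 ?size_iota ?mul1n.
by rewrite mem_iota => /fE.
Qed.

Lemma count_iota_pred1 (m i : nat) : i < m -> count (pred1 i) (iota 0 m) = 1.
Proof. by move=> im; rewrite count_uniq_mem ?iota_uniq // mem_iota /= im. Qed.

(** Cutting the points into consecutive intervals, the varying points first and then [C], [D], [E],
    lets sizes and intersections be computed block by block. *)
Definition layout (m c d e : nat) (g : pred nat) (u v w : bool) : pred nat :=
  fun x => if x < m then g x else if x < m + c then u
           else if x < m + c + d then v else if x < m + c + d + e then w
           else false.

Lemma count_layout (n m c d e : nat) (g : pred nat) (u v w : bool) :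
  m + c + d + e <= n ->
  count (layout m c d e g u v w) (iota 0 n) =
  count g (iota 0 m) + u * c + v * d + w * e.
Proof.
move=> le_n; rewrite -(subnKC le_n) !iotaD !count_cat.
rewrite (eq_in_count (a2 := g)) => [|x]; last first.
  by rewrite mem_iota /layout => /andP[_ ->].
rewrite (@count_iota_const _ u) => [|x xr]; last first.
  by rewrite /layout; do !case: ifP => //; lia.
rewrite (@count_iota_const _ v) => [|x xr]; last first.
  by rewrite /layout; do !case: ifP => //; lia.
rewrite (@count_iota_const _ w) => [|x xr]; last first.
  by rewrite /layout; do !case: ifP => //; lia.
rewrite (@count_iota_const _ false) => [|x xr]; last first.
  by rewrite /layout; do !case: ifP => //; lia.
by rewrite mul0n addn0.
Qed.

Lemma layoutI m c d e g g' u u' v v' w w' x :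
  layout m c d e g u v w x && layout m c d e g' u' v' w' x =
  layout m c d e (predI g g') (u && u') (v && v') (w && w') x.
Proof. by rewrite /layout; do !case: ifP. Qed.

Lemma ucycle_mkseq (T : eqType) (e : rel T) (v : nat -> T) (m : nat) :
  {in gtn m &, injective v} -> v m = v 0 ->
  (forall j, e (v j) (v j.+1)) -> ucycle e (mkseq v m).
Proof.
move=> v_inj vm ve; apply/andP; split; last first.
  rewrite map_inj_in_uniq ?iota_uniq // => i j.
  by rewrite !mem_iota => im jm; apply: v_inj.
(* Reading the endpoint [v 0] of the closing edge as [v m] turns the cycle into a path along
   consecutive indices. *)
case: m vm {v_inj} => // m vm; rewrite /mkseq /= -{2}vm -map_rcons.
have -> : rcons (iota 1 m) m.+1 = iota 1 m.+1.
  by rewrite -cats1 -(addn1 m) iotaD addnC.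
by elim: m.+1 0 {vm} => //= l IHl j; rewrite ve IHl.
Qed.

(* Even positions carry the sets [A_i] and odd positions the sets [B_i], whose
   traces on the [m] varying points are [h (2 * i)] and [h (2 * i + 1)]; [c] is
   the size of the fixed part of the intersections. *)
Lemma has_cycle_of_traces (n b c m r al be ga : nat) (h : nat -> pred nat) :
    2 < r -> al + c <= b -> be + c < b ->
    m + (b - al) + (b - be) <= n + c ->
    (forall j, count (h j) (iota 0 m) = if odd j then be else al) ->
    (forall j, count (predI (h j) (h j.+1)) (iota 0 m) = ga) ->
    h r = h 0 -> ~~ odd r ->
    (forall i j, i < r -> j < r -> odd i = odd j ->
       (forall x, x < m -> h i x = h j x) -> i = j) ->
  has_cycle_of_length (@adj n b (ga + c)) r.
Proof.
move=> r_gt2 le_al lt_be le_n h_size h_cap h_per r_even h_inj.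
(* The sizes of [D] and [E], which pad the even and odd sets up to [b] points; [lt_be] makes [E]
   nonempty. *)
set d := b - al - c; set e := b - be - c.
have le_n' : m + c + d + e <= n by lia.
pose f j := layout m c d e (h j) true (~~ odd j) (odd j).
have f_size j : \sum_(i < n) ([ffun i : 'I_n => f j i] i : nat) == b.
  under eq_bigr => i _ do rewrite ffunE.
  by rewrite sum_ord_count count_layout // h_size; case: odd; lia.
pose v j : vertex n b := Sub [ffun i : 'I_n => f j i] (f_size j).
split=> //; exists (mkseq v r); split; first by rewrite size_mkseq.
apply: ucycle_mkseq.
- move=> i j ir jr /(congr1 val)/ffunP fE.
  have {}fE x : x < n -> f i x = f j x.
    by move=> xn; have := fE (Ordinal xn); rewrite !ffunE.
  apply: h_inj => // [|x xm].
    (* a point of E separates the two parities *)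
    have := fE (m + c + d); rewrite /f /layout.
    have -> : (m + c + d < m) = false by lia.
    have -> : (m + c + d < m + c) = false by lia.
    have -> : (m + c + d < m + c + d + e) by lia.
    by rewrite ltnn; apply; lia.
  by have := fE x; rewrite /f /layout xm; apply; lia.
(* As [r] is even, positions [r] and [0] also agree on [D] and [E]. *)
- by apply: val_inj; rewrite /= /f h_per (negbTE r_even).
- move=> j; rewrite /adj /dotp /=.
  under eq_bigr => i _ do rewrite !ffunE mulnb layoutI.
  rewrite sum_ord_count count_layout // h_cap /=.
  by case: odd; rewrite !mul0n mul1n !addn0.
Qed.

Lemma has_cycle4 (n b a : nat) :
  2 * b <= n -> 0 < a -> a + 2 <= b -> has_cycle_of_length (@adj n b a) 4.
Proof.
move=> le_n a_gt0 le_b.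
(* The points 0, 1 are [q_0], [q_1] and the points 2, 3 are [p_0], [p_1]. *)
pose h j x := if odd j then x == j./2 %% 2 else (x < 2) || (x == 2 + j./2 %% 2).
have mod2 i : i %% 2 = 0 \/ i %% 2 = 1 by lia.
(* One common point, some [q_i], is a varying point, which leaves [a - 1] for [C]. *)
rewrite -(subnKC a_gt0); apply: (@has_cycle_of_traces _ _ _ 4 _ 3 1 _ h) => //.
- by lia.
- by lia.
- by lia.
- by move=> j; rewrite /h; case: odd; case: (mod2 j./2) => ->.
- move=> j; rewrite /h /=; case: odd => /=.
    by case: (mod2 j./2) => ->; case: (mod2 (uphalf j)) => ->.
  by case: (mod2 (uphalf j)) => ->; case: (mod2 j./2) => ->.
- case=> [|[|[|[|i]]]] [|[|[|[|j]]]] // _ _ _ hE.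
  + by have := hE 2 isT.
  + by have := hE 0 isT.
  + by have := hE 2 isT.
  + by have := hE 0 isT.
Qed.

Lemma has_cycle_ge6 (n b a k : nat) :
    2 * b <= n -> 0 < a -> 2 < k -> a + k <= b ->
  has_cycle_of_length (@adj n b a) (2 * k).
Proof.
move=> le_n a_gt0 k_gt2 le_b; have k_gt0 : 0 < k by lia.
pose s i := i.+1 %% k.
pose h j x := if odd j then (x != j./2 %% k) && (x != s j./2) else x == j./2 %% k.
have mod_lt i : i %% k < k by rewrite ltn_mod.
have sE i : s i = if (i %% k).+1 == k then 0 else (i %% k).+1.
  rewrite /s -addn1 -modnDml addn1; case: eqP => [->|]; first by rewrite modnn.
  by move=> neq_k; rewrite modn_small //; have := mod_lt i; lia.
have s_neq i : s i != i %% k by rewrite sE; case: ifP; lia.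
rewrite -(add0n a); apply: (@has_cycle_of_traces _ _ _ k _ 1 (k - 2) _ h).
- by lia.
- by lia.
- by lia.
- by lia.
- move=> j; rewrite /h; case: odd; last exact: count_iota_pred1.
  (* Inclusion-exclusion: the complement of the two distinct points [p], [q] in [P] has [k - 2]
     elements. *)
  set p := j./2 %% k; set q := s _.
  have := count_predC (predU (pred1 p) (pred1 q)) (iota 0 k).
  have := count_predUI (pred1 p) (pred1 q) (iota 0 k).
  rewrite !count_iota_pred1 ?mod_lt // size_iota.
  rewrite (eq_count (a1 := predI _ _) (a2 := pred0)); last first.
    by move=> x /=; have := s_neq j./2; rewrite -/p -/q; lia.
  rewrite count_pred0 (eq_count (a1 := predC _) (a2 := fun x => (x != p) && (x != q))).
    by rewrite addn0 => -> /(canRL (addKn _)).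
  by move=> x /=; rewrite negb_or.
- move=> j; rewrite (eq_count (a2 := pred0)) ?count_pred0 // => x.
  rewrite /h /= uphalf_half /s; case: (odd j) => /=; last by lia.
  by rewrite add1n; lia.
- rewrite /h /s mul2n odd_double doubleK /=.
  by rewrite modnn mod0n.
- by rewrite mul2n odd_double.
- move=> i j ir jr oij hE.
  suff: i./2 = j./2 by lia.
  have {ir} ik : i./2 < k by lia.
  have {jr} jk : j./2 < k by lia.
  move: hE; rewrite /h oij; move: (i./2) (j./2) ik jk => p q pk qk.
  case: odd => hE; last by have := hE p pk; rewrite !modn_small // eqxx; lia.
  (* Equal complements give [p] in [{q, q + 1}] and [q] in [{p, p + 1}] modulo [k]; if [p] and [q]
     differed, [k] would divide 2, against [2 < k]. *)
  have := hE p pk; have := hE q qk; rewrite !sE !modn_small // !eqxx /=.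
  by do !case: ifP; lia.
Qed.

Theorem theorem8 (n b a k : nat)
  (n_gt0 : 0 < n) (b_gt0 : 0 < b) (a_gt0 : 0 < a) (k_gt0 : 0 < k)
  (le_b_n2 : 2 * b <= n) (k_ge2 : 2 <= k) (le_a_bk : a + k <= b) :
  has_cycle_of_length (@adj n b a) (2 * k).
Proof.
have [k_gt2|k_le2] := ltnP 2 k; first exact: has_cycle_ge6.
have k2 : k = 2 by lia.
by rewrite k2 in le_a_bk *; apply: has_cycle4.
Qed.
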